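(* Let $P$ be a set whose cardinality $\kappa=|P|$ is infinite, and let $\mathfrak B=(\mathcal P(P),\triangle,\cap)$, regarded as an algebra over $R=\mathbb Z_2$. Then there exist $2^{2^\kappa}$-many non-surjective local automorphisms of $\mathfrak B$, as well as $2^{2^\kappa}$-many bijective local automorphisms of $\mathfrak B$ that are not $R$-algebra automorphisms of $\mathfrak B$.
   Context: $\mathcal P(P)$ is the power set of $P$, with symmetric difference $\triangle$ as addition and intersection $\cap$ as multiplication; this $\mathbb Z_2$-algebra is naturally isomorphic to $\Pi=\prod_{x\in P}\mathbb Z_2e_x$. A local automorphism of $\mathfrak B$ is a $\mathbb Z_2$-linear map $\eta:\mathfrak B\to\mathfrak B$ (i.e. a homomorphism with respect to $\triangle$) such that for each $X\in\mathfrak B$ there is a $\mathbb Z_2$-algebra automorphism $\varphi$ of $\mathfrak B$ with $\eta(X)=\varphi(X)$. *)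

(* Defs.v *)
From HB Require Import structures.
From mathcomp Require Import all_boot all_order all_algebra.
From mathcomp Require Import boolp classical_sets functions cardinality.

Set Implicit Arguments.
Unset Strict Implicit.
Unset Printing Implicit Defensive.

Import GRing.Theory.

Local Open Scope classical_set_scope.
Local Open Scope card_scope.
Local Open Scope ring_scope.

(* The infiniteness proof is a phantom parameter: MathComp algebras have to be
   nontrivial, so the algebra instance below needs P to be nonempty. *)
Definition power_algebra (P : Type) (infP : infinite_set [set: P]) : Type :=
  set P.

Section PowerAlgebra.
Variables (P : Type) (infP : infinite_set [set: P]).
Local Notation B := (power_algebra infP).

HB.instance Definition _ := Choice.copy B (set P).

Fact power_addNr : left_inverse (set0 : B) id (@setY P).
Proof. exact: setYK. Qed.

HB.instance Definition _ := GRing.isZmodule.Build B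
  (@setYA P) (@setYC P) (@set0Y P) power_addNr.

Fact power_oner_neq0 : [set: P] != set0 :> B.
Proof. exact/set0P/infinite_setN0. Qed.

HB.instance Definition _ := GRing.Zmodule_isComNzRing.Build B
  (@setIA P) (@setIC P) (@setTI P) (@setIYl P) power_oner_neq0.

Definition power_scale (a : 'F_2) (X : B) : B := if a == 0 then 0 else X.

Fact power_scalerA a b X :
  power_scale a (power_scale b X) = power_scale (a * b) X.
Proof. by rewrite /power_scale mulf_eq0; do 2!case: eqP. Qed.

Fact power_scale1r : left_id 1 power_scale.
Proof. by []. Qed.

Fact power_scalerDr : right_distributive power_scale +%R.
Proof. by move=> a X Y; rewrite /power_scale; case: eqP; rewrite ?addr0. Qed.

Fact power_scalerDl X : {morph power_scale^~ X : a b / a + b}.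
Proof.
move=> a b; rewrite /power_scale.
case: a => [[|[|//]] ?]; case: b => [[|[|//]] ?] /=;
  rewrite ?(add0r, addr0) //.
by rewrite [RHS](power_addNr X).
Qed.

HB.instance Definition _ := GRing.Zmodule_isLmodule.Build 'F_2 B
  power_scalerA power_scale1r power_scalerDr power_scalerDl.

Fact power_scalerAl (a : 'F_2) (X Y : B) : a *: (X * Y) = (a *: X) * Y.
Proof.
rewrite -[LHS]/(power_scale _ _) -[a *: X]/(power_scale _ _) /power_scale.
by case: eqP; rewrite ?mul0r.
Qed.

HB.instance Definition _ := GRing.Lmodule_isLalgebra.Build 'F_2 B
  power_scalerAl.

HB.instance Definition _ := GRing.Lalgebra_isComAlgebra.Build 'F_2 B.

End PowerAlgebra.

Definition algebra_automorphism (R : pzRingType) (A : algType R)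
    (f : A -> A) : Prop :=
  [/\ linear f, monoid_morphism f & bijective f].

Definition local_automorphism (R : pzRingType) (A : algType R)
    (f : A -> A) : Prop :=
  linear f /\
  forall x : A, exists2 phi : A -> A, algebra_automorphism phi & f x = phi x.

(* Main.v *)
(* A map [eta] that is additive for the symmetric difference, fixes [P] and
   preserves the cardinality of every set also preserves the cardinality of
   complements; hence every [eta X] is the image of [X] under some permutation
   of [P], and [eta] is a local automorphism.
   An ultrafilter [U] without finite members gives two kinds of such maps.
   - Move [P] onto [P \ {q}] by a bijection, and let [q] belong to [eta X]
     exactly when [X] is in [U].  Only infinite sets acquire the extra point, so
     cardinalities are kept, but [{q}] is not a value of [eta].
   - Given a second such ultrafilter [V], let [eta X] be [X] with the membership
     of a fixed point [p] toggled when exactly one of [U], [V] contains [X];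
     only infinite sets are changed.  This is an involution fixing every
     singleton, hence not an algebra automorphism unless [U = V].
   A family of [2^kappa] subsets of [P] that is independent modulo finite sets
   gives [2^(2^kappa)] ultrafilters.  Its construction codes lists of lists of
   points by points, which is possible as [P * P] injects into [P]. *)
Require Import Defs.
From mathcomp Require Import all_boot all_order all_algebra.
From mathcomp Require Import boolp classical_sets functions cardinality.
From mathcomp Require Import filter.

Set Implicit Arguments.
Unset Strict Implicit.
Unset Printing Implicit Defensive.

Local Open Scope classical_set_scope.
Local Open Scope card_scope.

(** * Cardinal arithmetic *)

Lemma card_le_inj T U (u : U) (A : set T) (B : set U) :
  A #<= B -> exists2 f : T -> U, set_fun A B f & set_inj A f.
Proof.
elim/Ppointed: U => U in u B *; first by case: (no u).
by move=> /pcard_leP/injfunPex.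
Qed.

Lemma set_inj_card_le T U (A : set T) (B : set U) (f : T -> U) :
  set_fun A B f -> set_inj A f -> A #<= B.
Proof.
move=> fAB fI; have /injfunPex[g] := ex_intro2 _ _ f fAB fI.
exact: inj_card_le g.
Qed.

Lemma infinite_set_nat_inj T (A : set T) :
  infinite_set A -> exists2 g : nat -> T, forall n, A (g n) & injective g.
Proof.
move=> Ainf; have [a _] := infinite_setN0 Ainf.
have /(card_le_inj a)[g gA gI] := (infiniteP A).1 Ainf.
exists g => [n|m n]; first exact: gA.
by apply: gI; rewrite inE.
Qed.

Lemma card_eq_bij T U (u : U) (A : set T) (B : set U) :
  A #= B -> exists f : T -> U, set_bij A B f.
Proof.
elim/Ppointed: U => U in u B *; first by case: (no u).
by move=> /card_set_bijP.
Qed.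

(* The elements of [Q] are partial functions: a domain together with a total
   function whose values off the domain are irrelevant. *)
Lemma Zorn_pfun T U (Q : set T -> (T -> U) -> Prop) (D0 : set T) (f0 : T -> U) :
    Q D0 f0 ->
    (forall (C : set (set T * (T -> U))) D f, C !=set0 ->
       (forall c, C c -> Q c.1 c.2) ->
       total_on C (fun c d => c.1 `<=` d.1) ->
       D = \bigcup_(c in C) c.1 ->
       (forall c, C c -> {in c.1, f =1 c.2}) -> Q D f) ->
  exists D f, Q D f /\
    forall D' f', Q D' f' -> D `<=` D' -> {in D, f =1 f'} -> D' `<=` D.
Proof.
move=> Q0 QU; pose S := {c : set T * (T -> U) | `[< Q c.1 c.2 >]}.
(* Only a preorder: two pairs that differ off a common domain lie below each other. *)
pose R (s t : S) := `[< (val s).1 `<=` (val t).1 /\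
  {in (val s).1, (val s).2 =1 (val t).2} >].
pose mk D f (QDf : Q D f) : S := exist _ (D, f) (asboolT QDf).
pose s0 := mk _ _ Q0.
have [//||C totC|[[D f] /= /[dup]/asboolP QD Qb] max] := @ZL_preorder S s0 R.
- by move=> t; apply/asboolP; split.
- move=> r s t /asboolP[rs frs] /asboolP[st fst]; apply/asboolP.
  split=> [|x xr]; first exact: subset_trans st.
  by rewrite frs// fst// inE; apply/rs/set_mem.
- have [[c0 Cc0]|C0] := pselect (C !=set0); last first.
    by exists s0 => s Cs; case: C0; exists s.
  pose D := \bigcup_(c in C) (val c).1.
  (* Each point of the union picks a member of the chain that is defined there; [c0] is the default
     elsewhere. *)
  have /choice[w wP] x : exists c, C c /\ (D x -> (val c).1 x).
    have [[c Cc cx]|nDx] := pselect (D x); first by exists c.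
    by exists c0; split.
  pose f x := (val (w x)).2 x.
  have fE c : C c -> {in (val c).1, f =1 (val c).2}.
    move=> Cc x; rewrite inE => cx; rewrite /f.
    have [Cw wx] := wP x; have {}wx : (val (w x)).1 x by apply: wx; exists c.
    have [/asboolP[_ ->]//|/asboolP[_ ->]//] := totC _ _ Cw Cc.
    - exact: mem_set.
    - exact: mem_set.
  have QDf : Q D f.
    apply: (QU [set val c | c in C]).
    + by exists (val c0), c0.
    + by move=> _ [c _ <-]; exact/asboolP/(valP c).
    + move=> _ _ [c Cc <-] [d Cd <-].
      by have [/asboolP[? _]|/asboolP[? _]] := totC _ _ Cc Cd; [left|right].
    + by rewrite bigcup_image.
    + by move=> _ [c Cc <-]; exact: fE.
  exists (mk _ _ QDf) => s Cs; apply/asboolP; split=> [x sx|x xs] /=.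
    by exists s.
  by rewrite (fE s).
exists D, f; split=> // D' f' QD' DD' ff'.
by have /asboolP[] := max (mk _ _ QD') (asboolT (conj DD' ff')).
Qed.

(** Take a maximal injection from a part [D] of [A] into [B]. If some point of [A] is left over, its
    image is all of [B], since otherwise that point could be sent to a missed value. *)
Lemma card_le_total T U (A : set T) (B : set U) : (A #<= B) || (B #<= A).
Proof.
have [[b0 Bb0]|/set0P/negP/negPn/eqP->] := pselect (B !=set0); last first.
  by rewrite card_ge0 orbT.
pose Q (D : set T) (f : T -> U) :=
  [/\ D `<=` A, set_fun D B f & set_inj D f].
have [|C D f _ CQ totC -> fE|D [f [[DA fB fI] max]]] :=
  @Zorn_pfun T U Q set0 (fun=> b0).
- by split=> // x; rewrite inE.
- split=> [x [c Cc cx]|x [c Cc cx]|x y].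
  + by have [cA _ _] := CQ c Cc; exact: cA.
  + by have [_ cB _] := CQ c Cc; rewrite (fE c)//; [exact: cB|exact: mem_set].
  + rewrite !inE => -[c Cc cx] [d Cd dy].
    have [e [Ce ex ey]] : exists e, [/\ C e, e.1 x & e.1 y].
      by have [/(_ _ cx)dx|/(_ _ dy)cy] := totC _ _ Cc Cd; [exists d|exists c].
    have [_ _ eI] := CQ e Ce.
    by rewrite !(fE e)//; try exact: mem_set; apply: eI; exact: mem_set.
have [AD|nAD] := pselect (A `<=` D).
  by rewrite (_ : A = D) ?(set_inj_card_le fB fI)//; exact/seteqP.
apply/orP; right.
have /existsNP[a /not_implyP[Aa nDa]] := nAD.
apply: card_le_trans (_ : B #<= f @` D) _; last first.
  by apply: card_le_trans (card_image_le _ _) (subset_card_le DA).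
apply: subset_card_le; apply: contrapT => /existsNP[b /not_implyP[Bb nfb]].
pose f' x := if x \in D then f x else b.
have f'D x : D x -> f' x = f x by move=> Dx; rewrite /f' mem_set.
have f'a : f' a = b by rewrite /f' memNset.
apply: (nDa); apply: (max (D `|` [set a]) f'); last 1 first.
- by right.
- split=> [x [/DA//|->//]|x [Dx|->]|x y].
  + by rewrite f'D//; exact: fB.
  + by rewrite f'a.
  + rewrite !inE => -[Dx|->] [Dy|->]//; rewrite ?f'a.
    * by rewrite !f'D//; apply: fI; exact: mem_set.
    * by rewrite f'D// => fx; case: nfb; exists x.
    * by rewrite f'D// => fy; case: nfb; exists y.
- by move=> x; left.
- by move=> x; rewrite inE => /f'D.
Qed.

Definition pairing_on T (A : set T) (f : T * T -> T) :=
  set_fun (A `*` A) A f /\ set_inj (A `*` A) f.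

Lemma pairing_on_in T (A : set T) f x y :
  pairing_on A f -> A x -> A y -> A (f (x, y)).
Proof. by move=> [fA _] Ax Ay; exact: (fA (x, y)). Qed.

Lemma pairing_on_eq T (A : set T) f x y x' y' : pairing_on A f ->
  A x -> A y -> A x' -> A y' -> f (x, y) = f (x', y') -> x = x' /\ y = y'.
Proof.
move=> [_ fI] Ax Ay Ax' Ay' fE.
have xyA := mem_set (conj Ax Ay : (A `*` A) (x, y)).
have xyA' := mem_set (conj Ax' Ay' : (A `*` A) (x', y')).
by have [] := fI _ _ xyA xyA' fE.
Qed.

(** Two distinct points [g 0] and [g 1] of [A] act as tags: points of [A] get the first, and the
    images under [r] of the remaining points get the second. *)
Lemma pairing_on_code T (A B : set T) f (r : T -> T) : pairing_on A f ->
    infinite_set A -> set_fun B A r -> set_inj B r ->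
  exists2 c : T -> T, set_fun (A `|` B) A c & set_inj (A `|` B) c.
Proof.
move=> fP /infinite_set_nat_inj[g gA gI] rA rI.
have g01 : g 0 <> g 1 by move/gI.
exists (fun x => if x \in A then f (g 0, x) else f (g 1, r x)).
  move=> x ABx; have [|/negP] := boolP (x \in A); rewrite inE => Ax.
    exact: (pairing_on_in fP (gA 0)).
  by case: ABx => // Bx; exact: (pairing_on_in fP (gA 1) (rA _ Bx)).
have AB z : (A `|` B) z -> ~ A z -> B z by move=> [].
move=> x y; rewrite inE => ABx; rewrite inE => ABy.
have [|/negP] := boolP (x \in A); rewrite inE => Ax;
have [|/negP] := boolP (y \in A); rewrite inE => Ay exy.
- by have [] := pairing_on_eq fP (gA 0) Ax (gA 0) Ay exy.
- by have [] := pairing_on_eq fP (gA 0) Ax (gA 1) (rA _ (AB _ ABy Ay)) exy.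
- have [/esym] := pairing_on_eq fP (gA 1) (rA _ (AB _ ABx Ax)) (gA 0) Ay exy.
  by [].
- have rx := rA _ (AB _ ABx Ax); have ry := rA _ (AB _ ABy Ay).
  have [_] := pairing_on_eq fP (gA 1) rx (gA 1) ry exy.
  by apply: rI; apply/mem_set/AB.
Qed.

(** Hessenberg's theorem, by Zorn: take a maximal pairing on some infinite [A]. If the complement of
    [A] injects into [A], then all of [T] is coded in [A]. Otherwise the complement contains a copy
    of [A], which leaves room to extend the pairing. *)
Lemma infinite_pairing T : infinite_set [set: T] ->
  exists e : T * T -> T, injective e.
Proof.
move=> Tinf.
pose Q (D : set (T * T)) f :=
  exists A : set T, [/\ D = A `*` A, infinite_set A & pairing_on A f].
have [g _ gI] := infinite_set_nat_inj Tinf.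
pose g' x := xget 0 [set n | g n = x].
have gK n : g' (g n) = n.
  by rewrite /g'; case: xgetP => [y _ /gI//|/(_ n)]; case.
(* Starting point: a countable set, paired through the coding of [nat * nat] in [nat]. *)
pose f0 u := g (pickle (g' u.1, g' u.2)).
have [|C D f [c0 Cc0] CQ totC DE fE|D [f [[A [-> Ainf fP]] max]]] :=
  @Zorn_pfun (T * T) T Q (range g `*` range g) f0.
- exists (range g); split=> //.
    apply/infiniteP/(@set_inj_card_le _ _ _ _ g) => [n _|m n _ _].
      exact: imageT.
    exact: gI.
  split=> [[x y] _|[x y] [x' y']]; first exact: imageT.
  rewrite !inE /f0 /= => -[[m _ <-] [n _ <-]] [[m' _ <-] [n' _ <-]].
  by move=> /gI/(pcan_inj pickleK); rewrite !gK => -[-> ->].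
(* The side of the square [D] is recovered from its diagonal. *)
- pose A := [set x | D (x, x)].
  have CA c : C c -> exists B,
      [/\ c.1 = B `*` B, B `<=` A, infinite_set B & pairing_on B c.2].
    move=> Cc; have [B [cB Binf BP]] := CQ c Cc; exists B; split=> // x Bx.
    by rewrite /A/= DE; exists c => //; rewrite cB.
  have Dup u v : D u -> D v -> exists c, [/\ C c, c.1 u & c.1 v].
    rewrite DE => -[c Cc cu] [d Cd dv].
    by have [/(_ _ cu)du|/(_ _ dv)cv] := totC _ _ Cc Cd; [exists d|exists c].
  have DA : D = A `*` A.
    apply/seteqP; split=> -[x y] /=.
      rewrite DE => -[c Cc]; have [B [-> BA _ _]] := CA c Cc.
      by move=> [/= /BA Ax /BA Ay].
    move=> [/= Ax /(Dup _ _ Ax)[c [Cc]]]; have [B [cB _ _ _]] := CA c Cc.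
    rewrite cB => -[/= Bx _] [/= By _].
    by rewrite DE; exists c => //; rewrite cB.
  exists A; split=> //.
    by have [B [_ BA + _]] := CA c0 Cc0; apply: sub_infinite_set.
  split; rewrite -DA; last move=> u v /set_mem Du /set_mem Dv.
    move=> u Du; have [c [Cc cu _]] := Dup u u Du Du.
    have [B [cB BA _ [cf _]]] := CA c Cc.
    by rewrite (fE c)//; [apply/BA/cf; rewrite -cB|exact: mem_set].
  have [c [Cc cu cv]] := Dup u v Du Dv; have [B [cB _ _ [_]]] := CA c Cc.
  by rewrite -cB !(fE c) ?inE// => cI; apply: cI; exact: mem_set.
have [a Aa] := infinite_setN0 Ainf.
have [leAC|leCA] := orP (card_le_total A (~` A)); last first.
  have [r rA rI] := card_le_inj a leCA.
  have [c] := pairing_on_code fP Ainf rA rI; rewrite setUv => cA cI.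
  exists (fun u => f (c u.1, c u.2)) => -[x y] [x' y'] /=.
  move=> /(pairing_on_eq fP (cA x I) (cA y I) (cA x' I) (cA y' I))[].
  move=> /(cI _ _ (mem_set I) (mem_set I))->.
  by move=> /(cI _ _ (mem_set I) (mem_set I))->.
have [r0 _ _] := card_le_inj a leAC.
have {leAC r0}[r rA rI] := card_le_inj (r0 a) leAC.
have [s sA sI] := card_le_inj a (card_image_le r A).
have {s sA sI}[c cA cI] := pairing_on_code fP Ainf sA sI.
pose B := A `|` r @` A.
(* New pairs are coded inside [A] by [c], then moved by [r] into the copy outside [A], where they
   cannot meet the old values. *)
pose f' u := if u \in A `*` A then f u else r (f (c u.1, c u.2)).
have fAA u : u \in A `*` A -> A (f u) by rewrite inE; apply: fP.1.
have fc u : (B `*` B) u -> A (f (c u.1, c u.2)).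
  by case: u => x y [/= Bx By]; apply: (pairing_on_in fP); apply: cA.
have : B `*` B `<=` A `*` A.
  apply: (max _ f'); last 2 first.
  - by move=> [x y] [/= ? ?]; split; left.
  - by move=> u uA; rewrite /f' uA.
  exists B; split=> //; first by apply: sub_infinite_set Ainf => x; left.
  split=> [u Bu|u v /set_mem Bu /set_mem Bv]; rewrite /f'.
    case: ifPn => [/fAA|_]; first by left.
    by right; exists (f (c u.1, c u.2)) => //; exact: fc.
  case: ifPn => [uA|_]; case: ifPn => [vA|_].
  - exact: fP.2.
  - by move=> E; case: (rA _ (fc _ Bv)); rewrite -E; exact: fAA.
  - by move=> E; case: (rA _ (fc _ Bu)); rewrite E; exact: fAA.
  move=> /(rI _ _ (mem_set (fc _ Bu)) (mem_set (fc _ Bv))).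
  case: u v Bu Bv => [x y] [x' y'] [/= Bx By] [/= Bx' By'].
  move=> /(pairing_on_eq fP (cA _ Bx) (cA _ By) (cA _ Bx') (cA _ By'))[].
  move=> /(cI _ _ (mem_set Bx) (mem_set Bx'))->.
  by move=> /(cI _ _ (mem_set By) (mem_set By'))->.
have ra : B (r a) by right; exists a.
by move=> /(_ (r a, r a) (conj ra ra))[/(rA _ Aa)].
Qed.

(** The length is stored along with the iterated pairing because the end marker [g 0] may itself be
    the code of a pair. *)
Lemma infinite_seq_inj T : infinite_set [set: T] ->
  exists c : seq T -> T, injective c.
Proof.
move=> Tinf; have [e eI] := infinite_pairing Tinf.
have [g _ gI] := infinite_set_nat_inj Tinf.
exists (fun s => e (g (size s), foldr (fun x a => e (x, a)) (g 0) s)).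
move=> s t /eI[/gI]; elim: s t => [|x s IH] [|y t] //= [st].
by move=> /eI[-> /(IH _ st)->].
Qed.

(** * Independent families and free ultrafilters *)

(** Independence modulo finite sets, as infinitely many points are required. Reading the signs from
    one set [S] keeps repeated indices in [L] consistent. *)
Definition independent_family (I : eqType) T (F : I -> set T) :=
  forall (S : set I) (L : seq I),
    infinite_set [set p | forall i, i \in L -> F i p <-> S i].

Lemma independent_family_powerset T : infinite_set [set: T] ->
  exists F : option (set T) -> set T, independent_family F.
Proof.
(* A point codes a list [s] of points together with a list [ts] of candidate
   traces on [s], and belongs to [F (Some X)] iff the trace of [X] on [s] is one
   of the [ts]; the boolean decides membership in [F None], and the natural
   number makes every combination occur infinitely often. *)
elim/Pchoice: T => T Tinf; have [e eI] := infinite_pairing Tinf.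
have [c cI] := infinite_seq_inj Tinf.
have [g _ gI] := infinite_set_nat_inj Tinf.
pose j (u : (nat * bool) * seq (seq T)) := e (g (pickle u.1), c (map c u.2)).
have jI : injective j.
  by move=> [m s] [n t] /eI[/gI/(pcan_inj pickleK)/=-> /cI/(inj_map cI)->].
pose tr (X : set T) (s : seq T) := [seq p <- s | p \in X].
pose F i := j @` [set u : (nat * bool) * seq (seq T) | if i is Some X
  then tr X (head [::] u.2) \in behead u.2 else u.1.2].
have FE i u : F i (j u) <-> if i is Some X
    then tr X (head [::] u.2) \in behead u.2 else u.1.2.
  by split=> [[v + /jI <-//]|Fu]; exists u.
exists F => S L.
pose p0 := g 0.
pose sep (X Y : set T) := xget p0 (X `+` Y).
have sepP X Y : X <> Y -> (sep X Y \in X) != (sep X Y \in Y).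
  move=> XY; rewrite /sep; case: xgetP => [x _|XY0].
    by move=> [[Xx Yx]|[Xx Yx]]; rewrite (mem_set Xx) (memNset Yx).
  case: XY; apply/seteqP; split=> x Xx; apply: contrapT => nx; apply: (XY0 x).
    by left.
  by right.
pose L' := pmap id L.
have L'P X : Some X \in L -> X \in L'.
  by rewrite mem_pmap map_id.
(* Any two distinct sets of [L'] have distinct traces on [s]. *)
pose s := [seq sep X Y | X <- L', Y <- L'].
pose ts := [seq tr X s | X <- L' & `[< S (Some X) >]].
apply/infiniteP.
apply: (@set_inj_card_le _ _ _ _ (fun n => j ((n, `[< S None >]), s :: ts))).
  move=> n _ /= [X|] iL; rewrite FE /=; last by rewrite asboolE.
  have XL' := L'P _ iL.
  split=> [/mapP[Y]|SX]; last by apply: map_f; rewrite mem_filter XL' asboolT.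
  rewrite mem_filter => /andP[/asboolP SY YL'] trE.
  have [->//|XY] := pselect (X = Y).
  have xs : sep X Y \in s by apply/allpairsP; exists (X, Y).
  have := sepP _ _ XY.
  have := congr1 (fun t => sep X Y \in t) trE.
  by rewrite !mem_filter xs !andbT => ->; rewrite eqxx.
by move=> m n _ _ /jI[].
Qed.

Definition free_ultrafilter T (U : set_system T) :=
  UltraFilter U /\ forall E, finite_set E -> ~ U E.

Lemma filter_setC_false T (U : set_system T) (UF : ProperFilter U) X :
  U X -> U (~` X) -> False.
Proof.
move=> UX UnX; apply: (@filter_not_empty _ U).
by rewrite -(setICr X); exact: filterI.
Qed.

(** The sets [base L] with finitely many points removed generate a proper filter, because each
    [base L] is infinite; any ultrafilter above it is free and has the prescribed trace on [F]. *)
Lemma independent_ultrafilter (I : eqType) T (F : I -> set T) (S : set I) :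
  independent_family F ->
  exists2 U : set_system T, free_ultrafilter U & forall i, U (F i) <-> S i.
Proof.
move=> Find.
pose base (L : seq I) := [set p | forall i, i \in L -> F i p <-> S i].
pose G : set_system T :=
  [set Y | exists L E, finite_set E /\ base L `\` E `<=` Y].
have GP : ProperFilter G.
  split=> [[L [E [Efin]]]|].
    have bEinf := infinite_setD (Find S L) Efin.
    by move=> sub0; have [x /sub0] := infinite_setN0 bEinf.
  split.
  - by exists [::], set0; split.
  - move=> X Y [L [E [Efin LX]]] [M [D [Dfin MY]]].
    exists (L ++ M), (E `|` D); split; first by rewrite finite_setU.
    move=> x [bx /not_orP[nEx nDx]]; split.
      by apply: LX; split=> // i iL; apply: bx; rewrite mem_cat iL.
    by apply: MY; split=> // i iL; apply: bx; rewrite mem_cat iL orbT.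
  - move=> X Y XY [L [E [Efin LX]]]; exists L, E; split=> //.
    exact: subset_trans XY.
have [U [UU GU]] := ultraFilterLemma GP.
have UN X : U X -> U (~` X) -> False by exact: filter_setC_false.
exists U.
  split=> // E Efin UE; apply: (UN E) => //; apply: GU.
  by exists [::], E; split=> // x [].
move=> i; split=> [UFi|Si].
  apply: contrapT => nSi; apply: (UN _ UFi); apply: GU.
  exists [:: i], set0; split=> // x [bx _] Fx.
  by apply/nSi/(bx i); rewrite ?inE.
apply: GU; exists [:: i], set0; split=> // x [bx _].
by apply/(bx i); rewrite ?inE.
Qed.

Section FreeUltrafilter.
Context {T : Type} {U : set_system T} (HU : free_ultrafilter U).
#[local] Instance free_ultrafilter_proper : ProperFilter U :=
  @ultra_proper _ _ HU.1.

Lemma free_ultrafilterC X : U (~` X) <-> ~ U X.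
Proof.
split=> [UnX UX|nUX]; last by have [|] := in_ultra_setVsetC X HU.1.
exact: filter_setC_false UX UnX.
Qed.

Lemma free_ultrafilterT : U setT. Proof. exact: filterT. Qed.

Lemma free_ultrafilterI X Y : U (X `&` Y) <-> U X /\ U Y.
Proof.
split=> [UXY|[UX UY]]; last exact: filterI.
by split; apply: filterS UXY => x [].
Qed.

(** The right-hand side is an exclusive or: membership in [U] is additive with values in the field
    of two elements. *)
Lemma free_ultrafilterY X Y : U (X `+` Y) <-> (U X <-> ~ U Y).
Proof.
rewrite setYE setDE free_ultrafilterI free_ultrafilterC free_ultrafilterI.
rewrite -(setCK (X `|` Y)) setCU free_ultrafilterC free_ultrafilterI.
rewrite !free_ultrafilterC.
by have [?|?] := pselect (U X); have [?|?] := pselect (U Y); tauto.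
Qed.

Lemma free_ultrafilter_infinite X : U X -> infinite_set X.
Proof. by move=> UX Xfin; case: HU => _ /(_ _ Xfin). Qed.

End FreeUltrafilter.

(** * Local automorphisms of the power set algebra *)

Lemma card_eq_preimage T (X Y : set T) : Y #= X -> ~` Y #= ~` X ->
  exists2 f : T -> T, bijective f & f @^-1` X = Y.
Proof.
elim/Ppointed: T => T in X Y *.
  by rewrite !empty_eq0 => _ _; exists id => //; exists id.
move=> /card_set_bijP[f [fX fI fS]] /card_set_bijP[g [gX gI gS]].
pose h x := if x \in Y then f x else g x.
have hY x : Y x -> h x = f x by move=> Yx; rewrite /h mem_set.
have hC x : ~ Y x -> h x = g x by move=> Yx; rewrite /h memNset.
have hP x : X (h x) <-> Y x.
  split=> [|Yx]; last by rewrite hY//; exact: fX.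
  by apply: contraPP => nYx; rewrite hC//; exact: gX.
exists h; last by apply/seteqP; split=> x /hP.
rewrite -setTT_bijective; split=> // [x y _ _ hxy|x _].
  have [Yx|nYx] := pselect (Y x).
    have Yy : Y y by apply/hP; rewrite -hxy; apply/hP.
    by move: hxy; rewrite !hY//; apply: fI; exact: mem_set.
  have nYy : ~ Y y by move=> Yy; apply/nYx/hP; rewrite hxy; apply/hP.
  by move: hxy; rewrite !hC//; apply: gI; exact: mem_set.
have [Xx|nXx] := pselect (X x).
  by have [y Yy <-] := fS _ Xx; exists y => //; rewrite hY.
by have [y Yy <-] := gS _ nXx; exists y => //; rewrite hC.
Qed.

(** Hilbert's hotel along the sequence [g]: [x] goes to [g 0], and [g n] to [g n.+1]. *)
Lemma infinite_setU1 T (X : set T) x : infinite_set X -> X `|` [set x] #= X.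
Proof.
move=> Xinf; have [Xx|nXx] := pselect (X x).
  by rewrite (_ : _ `|` _ = X)//; apply/seteqP; split=> [y [|->]|y]//; left.
rewrite card_eq_le (subset_card_le (@subsetUl _ X [set x])) andbT.
have [g gX gI] := infinite_set_nat_inj Xinf.
elim/Pchoice: T => T in X x Xinf nXx g gX gI *.
have gx n : g n <> x by move=> E; apply: nXx; rewrite -E.
pose k y := xget 0 [set n | g n = y].
have gK n : k (g n) = n.
  by rewrite /k; case: xgetP => [m _ /gI//|/(_ n)]; case.
pose h y := if y == x then g 0
            else if y \in range g then g (k y).+1 else y.
have hx : h x = g 0 by rewrite /h eqxx.
have hg n : h (g n) = g n.+1.
  by rewrite /h (negbTE (introN eqP (gx n))) mem_set ?gK//; exact: imageT.
have hX y : ~ (y = x) -> ~ range g y -> h y = y.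
  by move=> /eqP/negbTE yx gy; rewrite /h yx memNset.
have hP y : [\/ y = x, exists n, y = g n | ~ (y = x) /\ ~ range g y].
  have [|yx] := pselect (y = x); first exact: Or31.
  have [[n _ <-]|gy] := pselect (range g y); last exact: Or33.
  by apply: Or32; exists n.
apply: (@set_inj_card_le _ _ _ _ h) => [y|y z _ _].
  have [->|[n ->]|[yx gy]] := hP y.
  - by rewrite hx => _; exact: gX.
  - by rewrite hg => _; exact: gX.
  - by rewrite hX//; case.
have [->|[n ->]|[yx gy]] := hP y; have [->|[m ->]|[zx gz]] := hP z;
  rewrite ?hx ?hg ?hX//.
- by move/gI.
- by move=> E; case: gz; exists 0.
- by move/gI.
- by move/gI => -[->].
- by move=> E; case: gz; exists n.+1.
- by move=> E; case: gy; exists 0.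
- by move=> E; case: gy; exists m.+1.
Qed.

Lemma infinite_setD1 T (X : set T) x : infinite_set X -> X `\ x #= X.
Proof.
move=> Xinf; have [Xx|nXx] := pselect (X x); last by rewrite not_setD1.
rewrite -[in X in _ #= X](setD1K Xx) card_eq_sym setUC.
apply: infinite_setU1; exact: infinite_setD.
Qed.

Lemma infinite_setY1 T (X : set T) x : infinite_set X -> X `+` [set x] #= X.
Proof.
move=> Xinf; have [Xx|nXx] := pselect (X x).
  rewrite (_ : _ `+` _ = X `\ x); first exact: infinite_setD1.
  by rewrite /setY; apply/seteqP; split=> [y [//|[->]]//|y]; left.
rewrite (_ : _ `+` _ = X `|` [set x]); first exact: infinite_setU1.
rewrite /setY; apply/seteqP; split=> [y [[]|[]]|y [Xy|->]].
- by left.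
- by right.
- by left; split=> // yx; apply: nXx; rewrite -yx.
- by right.
Qed.

Section PowerAlgebra.
Context (P : Type) (infP : infinite_set [set: P]).
Local Notation B := (power_algebra infP).
Local Open Scope ring_scope.

(** The only scalars are 0 and 1. *)
Lemma power_algebra_linear (f : B -> B) :
  {morph f : X Y / X `+` Y} -> linear f.
Proof.
move=> fD a X Y.
have f0 : f (set0 : set P) = set0 by rewrite -{1}(setYK set0) fD setYK.
rewrite [LHS]fD -[a *: X]/(power_scale a X).
rewrite -[a *: f X]/(power_scale a (f X)) /power_scale; case: eqP => // _.
by rewrite -[RHS]/(set0 `+` f Y) -f0.
Qed.

Lemma preimage_algebra_automorphism (f : P -> P) :
  bijective f -> algebra_automorphism (fun X : B => f @^-1` X : B).
Proof.
move=> [g fK gK]; split.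
- exact: power_algebra_linear.
- by split.
- by exists (fun X : B => g @^-1` X : B) => X; apply/funext => x /=;
    rewrite /preimage/= ?fK ?gK.
Qed.

Lemma power_local_automorphism (f : B -> B) :
    {morph f : X Y / X `+` Y} -> f [set: P] = [set: P] ->
    (forall X : set P, (f X : set P) #= X) ->
  local_automorphism f.
Proof.
move=> fD fT fE; split=> [|X]; first exact: power_algebra_linear.
(* A complement is the sum with the full set, which [f] fixes. *)
have fC : ~` (f X : set P) #= ~` (X : set P).
  by rewrite -setTYC -fT -[X in X #= _]fD setTYC.
have [s sB <-] := card_eq_preimage (fE X) fC.
exists (fun X : B => s @^-1` X : B) => //.
exact: preimage_algebra_automorphism.
Qed.

(** The upper bound for both counts. The graph of [f], as the pairs of [X] and [y] with [y] in
    [f X], becomes a family of subsets of [P]: [l] and [r] embed [P] twice with disjoint ranges, so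
    one subset holds both [X] and [y]. *)
Lemma card_power_endofunctions (A : set (B -> B)) : A #<= [set: set (set P)].
Proof.
have [e eI] := infinite_pairing infP.
have [g _ gI] := infinite_set_nat_inj infP.
pose l x := e (g 0%N, x); pose r x := e (g 1%N, x).
have lI : injective l by move=> x y /eI[].
have rI : injective r by move=> x y /eI[].
have lr x y : l x <> r y by move=> /eI[/gI].
pose code (f : B -> B) : set (set P) :=
  [set Z | exists X y, (f X : set P) y /\ Z = l @` X `|` [set r y]].
apply: (@set_inj_card_le _ _ _ _ code) => // f h _ _ fh.
have codeP k X y : code k (l @` X `|` [set r y]) <-> (k X : set P) y.
  split=> [[X' [y' [ky' E]]]|ky]; last by exists X, y.
  have Ez z : (l @` X `|` [set r y]) z <-> (l @` X' `|` [set r y']) z.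
    by rewrite E.
  have -> : X = X'.
    apply/seteqP; split=> x Xx.
      have [] := (Ez (l x)).1 (or_introl (imageP l Xx)); last by move/lr.
      by move=> [x' ? /lI <-].
    have [] := (Ez (l x)).2 (or_introl (imageP l Xx)); last by move/lr.
    by move=> [x' ? /lI <-].
  have [] := (Ez (r y)).1 (or_intror erefl); first by move=> [x' _ /lr].
  by move=> /rI ->.
apply/funext => X; apply/seteqP; split=> y /codeP.
  by rewrite fh => /codeP.
by rewrite -fh => /codeP.
Qed.

Lemma card_powerpower_eq (A : set (B -> B)) (h : set (set P) -> B -> B) :
  injective h -> (forall S, A (h S)) -> A #= [set: set (set P)].
Proof.
move=> hI hA; rewrite card_eq_le card_power_endofunctions /=.
by apply: (@set_inj_card_le _ _ _ _ h) => // S S' _ _ /hI.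
Qed.

(** * Non-surjective local automorphisms *)

Section Shift.
Context (U : set_system P) (HU : free_ultrafilter U) (q : P) (t : P -> P).
Context (tB : set_bij [set~ q] [set: P] t).

(** [t] is the inverse of the bijection onto the complement of [q], so the moved set is a preimage
    under [t]. *)
Definition shift_map (X : B) : B :=
  [set y | if pselect (y = q) then U X else X (t y)].

Lemma shift_mapq X : shift_map X q = U X.
Proof. by rewrite /shift_map/=; case: pselect. Qed.

Lemma shift_mapE X y : y <> q -> shift_map X y = X (t y).
Proof. by rewrite /shift_map/=; case: pselect. Qed.

Lemma shift_map_local_automorphism : local_automorphism shift_map.
Proof.
apply: power_local_automorphism => [X Y||X].
- apply/funext => y; apply/propext.
  have [->|yq] := pselect (y = q); last by rewrite /setY/= !shift_mapE.
  rewrite shift_mapq (free_ultrafilterY HU) /setY/= !shift_mapq.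
  by have [?|?] := pselect (U X); have [?|?] := pselect (U Y); tauto.
- apply/seteqP; split=> // y _.
  have [->|yq] := pselect (y = q); last by rewrite shift_mapE.
  by rewrite shift_mapq; exact: free_ultrafilterT HU.
have [_ tI tS] := tB.
have XE : [set y | y <> q /\ (X : set P) (t y)] #= (X : set P).
  have {2}-> : (X : set P) = t @` [set y | y <> q /\ (X : set P) (t y)].
    apply/seteqP; split=> [x Xx|_ [y [_ ?] <-//]].
    by have [y yq tyx] := tS x I; exists y => //; split; rewrite ?tyx.
  rewrite card_eq_sym; apply: inj_card_eq => x y /set_mem[xq _] /set_mem[yq _].
  by apply: tI; exact: mem_set.
have [UX|nUX] := pselect (U X).
  rewrite (_ : shift_map X = [set y | y <> q /\ (X : set P) (t y)] `|` [set q]).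
    apply: (card_eq_trans _ XE); apply: infinite_setU1.
    by rewrite (eq_finite_set XE); exact: free_ultrafilter_infinite HU _ UX.
  apply/seteqP; split=> y.
    by have [->|yq] := pselect (y = q); [right|rewrite shift_mapE//; left].
  by move=> [[yq Xy]|->]; rewrite ?shift_mapq ?shift_mapE.
rewrite (_ : shift_map X = [set y | y <> q /\ (X : set P) (t y)])//.
apply/seteqP; split=> y.
  by have [->|yq] := pselect (y = q); rewrite ?shift_mapq ?shift_mapE.
by move=> [yq Xy]; rewrite shift_mapE.
Qed.

(** A set sent to the singleton of [q] must be empty, since [t] reaches every point from outside
    [q]; but the empty set is not in [U]. *)
Lemma shift_map_nonsurjective : ~ set_surj setT setT shift_map.
Proof.
move=> /(_ [set q : P] I)[X _ XE].
have X0 : X = set0 :> set P.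
  apply/seteqP; split=> // x Xx; have [_ _ /(_ x I)[y yq tyx]] := tB.
  apply: (yq); have : shift_map X y by rewrite shift_mapE// tyx.
  by rewrite XE.
have : shift_map X q by rewrite XE.
rewrite shift_mapq X0 => /(free_ultrafilter_infinite HU); apply.
exact: finite_set0.
Qed.

End Shift.

(** * Bijective local automorphisms that are not multiplicative *)

Section Toggle.
Context (U V : set_system P).
Context (HU : free_ultrafilter U) (HV : free_ultrafilter V) (p : P).

Definition toggle_map (X : B) : B := X `+` [set y | y = p /\ (U X <-> ~ V X)].

Let toggles X := U X <-> ~ V X.

Lemma togglesY X Y : toggles (X `+` Y) <-> (toggles X <-> ~ toggles Y).
Proof.
rewrite /toggles (free_ultrafilterY HU) (free_ultrafilterY HV).
by have [?|?] := pselect (U X); have [?|?] := pselect (U Y);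
   have [?|?] := pselect (V X); have [?|?] := pselect (V Y); tauto.
Qed.

Lemma toggles_fin X : finite_set X -> ~ toggles X.
Proof.
move=> Xfin; rewrite /toggles.
by have := HU.2 _ Xfin; have := HV.2 _ Xfin; tauto.
Qed.

Lemma toggle_mapT X : toggles X -> toggle_map X = X `+` [set p].
Proof.
by move=> tX; congr setY; apply/seteqP; split=> y; [case|move=> ->].
Qed.

Lemma toggle_mapF X : ~ toggles X -> toggle_map X = X.
Proof.
move=> ntX; rewrite -[RHS]setY0; congr setY.
by apply/seteqP; split=> // y [_].
Qed.

Lemma toggle_mapY : {morph toggle_map : X Y / X `+` Y}.
Proof.
move=> X Y; apply/funext => y; apply/propext.
rewrite /toggle_map /setY/= -!/(toggles _) togglesY.
have [?|?] := pselect (X y); have [?|?] := pselect (Y y);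
have [?|?] := pselect (y = p); have [?|?] := pselect (toggles X);
have [?|?] := pselect (toggles Y); tauto.
Qed.

(** Adding the finite set containing just [p] does not change whether a set toggles, so the second
    toggle undoes the first. *)
Lemma toggle_mapK : involutive toggle_map.
Proof.
move=> X; have [tX|ntX] := pselect (toggles X); last by rewrite !toggle_mapF.
rewrite (toggle_mapT tX) toggle_mapT -?setYA ?setYK ?setY0//.
by apply/togglesY; split=> // _; exact: toggles_fin.
Qed.

Lemma toggle_map_local_automorphism : local_automorphism toggle_map.
Proof.
apply: power_local_automorphism => [||X]; first exact: toggle_mapY.
  apply: toggle_mapF => -[+ _] => /(_ (free_ultrafilterT HU)).
  by apply; exact: free_ultrafilterT HV.
have [tX|ntX] := pselect (toggles X); last by rewrite toggle_mapF.
by rewrite toggle_mapT//; apply: infinite_setY1 => /toggles_fin.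
Qed.

(** Multiply [X] by the singleton of [p]: this singleton and the product are finite, hence fixed,
    whereas [X] itself has [p] toggled. *)
Lemma toggle_map_not_automorphism X :
  U X -> ~ V X -> ~ algebra_automorphism toggle_map.
Proof.
move=> UX nVX [_ [_ fM] _].
have nt Y : Y `<=` [set p] -> ~ toggles Y.
  by move=> Yp; apply/toggles_fin/(sub_finite_set Yp)/finite_set1.
have := congr1 (fun Z : set P => Z p) (fM X [set p : P]).
rewrite -[(X : B) * _]/(X `&` [set p]) -[toggle_map X * _]/(toggle_map X `&` _).
rewrite toggle_mapF; last by apply: nt => x [].
rewrite toggle_mapT// toggle_mapF; last exact: nt.
rewrite propeqE /setI /setY/=; have [?|?] := pselect (X p); tauto.
Qed.

End Toggle.
End PowerAlgebra.

Theorem theorem3p11 (P : Type) (infP : infinite_set [set: P]) :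
  [set eta : power_algebra infP -> power_algebra infP |
     local_automorphism eta /\ ~ set_surj setT setT eta]
    #= [set: set (set P)] /\
  [set eta : power_algebra infP -> power_algebra infP |
     [/\ local_automorphism eta, bijective eta & ~ algebra_automorphism eta]]
    #= [set: set (set P)].
Proof.
have [F Find] := independent_family_powerset infP.
have [q _] := infinite_setN0 infP.
have /choice[W WP] : forall S : set (option (set P)),
    exists W, free_ultrafilter W /\ forall i, W (F i) <-> S i.
  by move=> S; have [W ? ?] := independent_ultrafilter S Find; exists W.
(* The index [None] is held back: [F None] lies in [V] but in no [U S], so [V] differs from every
   [U S], including the one for the full set. *)
pose U S := W (Some @` S).
have UP S : free_ultrafilter (U S) by case: (WP (Some @` S)).
have US S X : U S (F (Some X)) <-> S X.
  rewrite /U (WP _).2; split=> [[Y SY [<-//]]|SX]; exact: imageP.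
have nUN S : ~ U S (F None) by rewrite /U (WP _).2 => -[].
have SE S S' : (forall X, U S (F (Some X)) <-> U S' (F (Some X))) -> S = S'.
  by move=> E; apply/seteqP; split=> X /US/E/US.
pose V := W setT.
have VP : free_ultrafilter V by case: (WP setT).
have VF i : V (F i) by apply/(WP setT).2.
split.
  have [t tB] : exists t, set_bij [set~ q] [set: P] t.
    by apply: (card_eq_bij q); rewrite -setTD; exact: infinite_setD1.
  apply: (@card_powerpower_eq _ _ _ (fun S => shift_map (U S) q t)).
    move=> S S' E; apply: SE => X.
    have := congr1 (fun f => (f (F (Some X)) : set P) q) E.
    by rewrite !shift_mapq => ->.
  move=> S; split; first exact: (shift_map_local_automorphism infP (UP S) tB).
  exact: (shift_map_nonsurjective (UP S) tB).
apply: (@card_powerpower_eq _ _ _ (fun S => toggle_map V (U S) q)).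
  move=> S S' E; apply: SE => X.
  have := congr1 (fun f => (f (F (Some X)) : set P) q) E.
  rewrite propeqE /toggle_map /setY/=.
  (* As [V] contains every [F (Some X)], toggling there happens exactly when [U S] does not contain
     it, so the map determines [S]. *)
  have := VF (Some X); have [?|?] := pselect (F (Some X) q);
  have [?|?] := pselect (U S (F (Some X)));
  have [?|?] := pselect (U S' (F (Some X))); tauto.
move=> S; split; first exact: (toggle_map_local_automorphism infP VP (UP S)).
- exact/inv_bij/(toggle_mapK VP (UP S)).
- exact: (toggle_map_not_automorphism VP (UP S) (VF None) (@nUN S)).
Qed.
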